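(* Let $\mathscr{J}$ be a Jacobi matrix with parameters $a_n\in\mathbb{R}$, $b_n>0$ ($n\ge0$) in limit circle case with corresponding Nevanlinna matrix $W=\begin{pmatrix}A&C\\ B&D\end{pmatrix}$. Then there is a constant $c>0$ such that for all sufficiently large $r$ $$\log|B(ir)|\ \ge\ c\,r\sum_{n=h(r)}^\infty\frac1{b_n},\qquad\text{where } h(r):=1+\max\{n\in\mathbb{N} : b_n<r\}.$$
   Context: The Jacobi matrix $\mathscr{J}$ is the semi-infinite symmetric tridiagonal matrix with diagonal $(a_0,a_1,\dots)$ and off-diagonal $(b_0,b_1,\dots)$, where $a_n\in\mathbb{R}$, $b_n>0$. It is in limit circle case if its minimal operator in $\ell^2$ is symmetric with deficiency indices $(1,1)$ (as opposed to self-adjoint, the limit point case). Let $p_n,q_n$ be the orthogonal polynomials of the first and second kind, i.e. the solutions of $b_nu_{n+1}+a_nu_n+b_{n-1}u_{n-1}=zu_n$, $n\ge1$, with $p_0=1$, $p_1(z)=(z-a_0)/b_0$, $q_0=0$, $q_1=1/b_0$. In limit circle case, the Nevanlinna matrix $W=\begin{pmatrix}A&C\\ B&D\end{pmatrix}$ consists of the entire functions $$A(z)=z\sum_{n=0}^\infty q_n(0)q_n(z),\quad B(z)=-1+z\sum_{n=0}^\infty q_n(0)p_n(z),$$ $$C(z)=1+z\sum_{n=0}^\infty p_n(0)q_n(z),\quad D(z)=z\sum_{n=0}^\infty p_n(0)p_n(z).$$ Here $\mathbb{N}=\{1,2,\dots\}$. *)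

(* Defs.v *)
From Stdlib Require Import Reals.
From Coquelicot Require Import Coquelicot.

Open Scope R_scope.
Open Scope C_scope.

(* A total sum of a complex series: it is the sum whenever the series converges
   in [C], since convergence in [C] is componentwise. *)
Definition CSeries (u : nat -> C) : C :=
  (Series (fun n => fst (u n)), Series (fun n => snd (u n))).

(** * The Hilbert space l^2 and operators in it *)

Definition ell2 (u : nat -> C) : Prop :=
  ex_series (fun n => (Cmod (u n) ^ 2)%R).

Definition inner (u v : nat -> C) : C :=
  CSeries (fun n => u n * Cconj (v n)).

Definition l2dist (u v : nat -> C) : R :=
  sqrt (Series (fun n => (Cmod (u n - v n) ^ 2)%R)).

(* Operators are represented by their graphs: [T u f] means that u is in the
   domain of T and T u = f, where u and f are meant to lie in l^2 (as they do for the
   Jacobi operators below). *)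
Definition graph : Type := (nat -> C) -> (nat -> C) -> Prop.

Definition closure (T : graph) : graph := fun u f =>
  ell2 u /\ ell2 f /\
  forall eps : R, (0 < eps)%R ->
    exists v g, T v g /\ (l2dist u v < eps)%R /\ (l2dist f g < eps)%R.

Definition adjoint (T : graph) : graph := fun v w =>
  ell2 v /\ ell2 w /\ forall u f, T u f -> inner f v = inner u w.

Definition densely_defined (T : graph) : Prop :=
  forall u, ell2 u -> forall eps : R, (0 < eps)%R ->
    exists v g, T v g /\ (l2dist u v < eps)%R.

Definition symmetric (T : graph) : Prop :=
  densely_defined T /\ forall u f, T u f -> adjoint T u f.

(* The linear subspace S has dimension d: e 1, ..., e d is a basis of S. *)
Definition has_dim (S : (nat -> C) -> Prop) (d : nat) : Prop :=
  exists e : nat -> nat -> C,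
    (forall i, (1 <= i <= d)%nat -> S (e i)) /\
    (forall k : nat -> C,
       (forall n, sum_n_m (fun i => k i * e i n) 1 d = RtoC 0) ->
       forall i, (1 <= i <= d)%nat -> k i = 0) /\
    (forall v, S v -> exists k : nat -> C,
       forall n, v n = sum_n_m (fun i => k i * e i n) 1 d).

(* ker (T^* - z) *)
Definition deficiency_space (T : graph) (z : C) (v : nat -> C) : Prop :=
  adjoint T v (fun n => z * v n).

Definition deficiency_indices (T : graph) (np nm : nat) : Prop :=
  has_dim (deficiency_space T Ci) np /\ has_dim (deficiency_space T (- Ci)) nm.

(** * Jacobi matrices with diagonal a and off-diagonal b *)

Definition jacobi_apply (a b : nat -> R) (u : nat -> C) (n : nat) : C :=
  match n with
  | O => a O * u O + b O * u 1%nat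
  | S m => b m * u m + a n * u n + b n * u (S n)
  end.

Definition jacobi_finite (a b : nat -> R) : graph := fun u f =>
  (exists N : nat, forall n, (N <= n)%nat -> u n = 0) /\
  (forall n, f n = jacobi_apply a b u n).

Definition jacobi_min (a b : nat -> R) : graph := closure (jacobi_finite a b).

Definition limit_circle (a b : nat -> R) : Prop :=
  symmetric (jacobi_min a b) /\ deficiency_indices (jacobi_min a b) 1 1.

(* The solution of b_n u_(n+1) + a_n u_n + b_(n-1) u_(n-1) = z u_n, n >= 1,
   with prescribed u_0 and u_1. *)
Fixpoint jacobi_solution (a b : nat -> R) (z u0 u1 : C) (n : nat) : C :=
  match n with
  | O => u0
  | S m =>
      match m with
      | O => u1
      | S k => ((z - a m) * jacobi_solution a b z u0 u1 m
                - b k * jacobi_solution a b z u0 u1 k) / b m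
      end
  end.

Definition poly_p (a b : nat -> R) (n : nat) (z : C) : C :=
  jacobi_solution a b z 1 ((z - a O) / b O) n.

Definition poly_q (a b : nat -> R) (n : nat) (z : C) : C :=
  jacobi_solution a b z 0 (1 / b O) n.

(** * The entries of the Nevanlinna matrix ((A, C), (B, D)) *)

Definition nevanlinna_A (a b : nat -> R) (z : C) : C :=
  z * CSeries (fun n => poly_q a b n 0 * poly_q a b n z).

Definition nevanlinna_B (a b : nat -> R) (z : C) : C :=
  - (1) + z * CSeries (fun n => poly_q a b n 0 * poly_p a b n z).

Definition nevanlinna_C (a b : nat -> R) (z : C) : C :=
  1 + z * CSeries (fun n => poly_p a b n 0 * poly_q a b n z).

Definition nevanlinna_D (a b : nat -> R) (z : C) : C :=
  z * CSeries (fun n => poly_p a b n 0 * poly_p a b n z).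

Definition is_max (E : nat -> Prop) (m : nat) : Prop :=
  E m /\ forall n, E n -> (n <= m)%nat.

(* h = 1 + max {n >= 1 : b_n < r}; the maximum exists for large r when b_n tends
   to infinity. *)
Definition is_h (b : nat -> R) (r : R) (h : nat) : Prop :=
  exists m : nat,
    is_max (fun n => (1 <= n)%nat /\ (b n < r)%R) m /\ h = (1 + m)%nat.

(* Main.v *)
Require Import Defs.
From Stdlib Require Import Reals Lra Lia.
From Coquelicot Require Import Coquelicot.

Open Scope R_scope.

(** Write [p_n] for [poly_p a b n (i r)] with [r > 0], and put
    [F_N = sum_(n <= N) |p_n|^2].  Two consequences of the Christoffel-Darboux formulas
    carry the proof.

    Growth of [F].  The Wronskian of the solutions [p_n] and [conj p_n] gives
    [r F_n <= b_n |p_n| |p_(n+1)|] ([kernel_le_Cmod_poly_p]).  By the inequality between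
    the arithmetic and geometric means, [r / b_n] is at most
    [((F_n - F_(n-1)) + (F_(n+1) - F_n)) / (2 F_n)].  If moreover [b_n >= r], so that
    [r / b_n <= 1], this forces
    [r / b_n <= ln (F_n / F_(n-1)) + 2 ln (F_(n+1) / F_n)] ([log_increment_bound]).
    All [b_n] with [n >= h(r)] are at least [r], and the right-hand sides telescope:
    [r sum_(h <= n <= N) 1 / b_n <= 3 ln F_(N+1)] ([sum_n_inv_le_ln_kernel]).

    Comparison of [F] with [B].  The partial sums [B_N] and [D_N] of the Nevanlinna
    functions are Wronskians of [p_n] with the second and first kind solutions at [0],
    and a Pluecker identity turns [D_N conj B_N - B_N conj D_N] into [2 i r F_N] up to
    sign.  Hence [r F_N <= |D_N| |B_N|], while Cauchy-Schwarz applied to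
    [D_N = i r sum p_n p_n(0)] gives [|D_N|^2 <= r^2 F_N P] with
    [P = sum p_n(0)^2].  Therefore [F_N <= P |B_N|^2] ([kernel_le_wronskian_p_q]), and in
    the limit [F_N <= P |B(ir)|^2].

    Together, [r sum_(n >= h) 1 / b_n <= 3 ln P + 6 ln |B(ir)|].  Already
    [F_1 >= r^2 / b_0^2] makes [|B(ir)|^2 >= P] for large [r], so that the constant
    [1 / 12] works.

    The limit circle hypothesis enters only through square summability: a deficiency
    vector at [i] is the conjugate of a multiple of [p_n(-i)]
    ([limit_circle_poly_p_Ci]), and then every solution at every point is dominated by
    [|p_n(i)|] ([solution_dominated]).  This yields the convergence of the series in
    [nevanlinna_B], the finiteness of [P], and the convergence of [sum 1 / b_n]. *)

(** * Sums and series *)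

Lemma sum_n_le_Series (x : nat -> R) (N : nat) :
  (forall n, 0 <= x n) -> ex_series x -> sum_n x N <= Series x.
Proof.
  intros Hx Hs.
  apply (is_lim_seq_incr_compare (sum_n x)).
  - apply (Series_correct x Hs).
  - intros n. rewrite sum_Sn. change plus with Rplus. specialize (Hx (S n)). lra.
Qed.

Lemma sum_n_nonneg (x : nat -> R) (N : nat) :
  (forall n, 0 <= x n) -> 0 <= sum_n x N.
Proof.
  intros Hx. induction N as [|N IH].
  - rewrite sum_O. apply Hx.
  - rewrite sum_Sn. change plus with Rplus. specialize (Hx (S N)). lra.
Qed.

Lemma sum_n_Cauchy_Schwarz (x y : nat -> R) (N : nat) :
  (sum_n (fun n => x n * y n) N) ^ 2
    <= sum_n (fun n => x n ^ 2) N * sum_n (fun n => y n ^ 2) N.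
Proof.
  induction N as [|N IH].
  - rewrite !sum_O. right. ring.
  - rewrite !sum_Sn. change plus with Rplus. cbn beta.
    assert (HX : 0 <= sum_n (fun n => x n ^ 2) N)
      by (apply sum_n_nonneg; intros; apply pow2_ge_0).
    assert (HY : 0 <= sum_n (fun n => y n ^ 2) N)
      by (apply sum_n_nonneg; intros; apply pow2_ge_0).
    revert IH HX HY.
    generalize (sum_n (fun n => x n * y n) N) (sum_n (fun n => x n ^ 2) N)
      (sum_n (fun n => y n ^ 2) N) (x (S N)) (y (S N)).
    intros s X Y u v IH HX HY.
    assert (Hcross : 2 * s * (u * v) <= X * v ^ 2 + Y * u ^ 2).
    { assert (H0 : 0 <= X * v ^ 2 + Y * u ^ 2)
        by (apply Rplus_le_le_0_compat; apply Rmult_le_pos;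
            auto; apply pow2_ge_0).
      apply Rsqr_incr_0_var; [|exact H0].
      unfold Rsqr.
      assert (H1 : s ^ 2 * (u * v) ^ 2 <= X * Y * (u * v) ^ 2)
        by (apply Rmult_le_compat_r; [apply pow2_ge_0 | exact IH]).
      assert (H2 : 0 <= (X * v ^ 2 - Y * u ^ 2) ^ 2) by apply pow2_ge_0.
      nra. }
    nra.
Qed.

Lemma sum_n_Cmod_le (u : nat -> C) (N : nat) :
  Cmod (sum_n u N) <= sum_n (fun n => Cmod (u n)) N.
Proof.
  induction N as [|N IH].
  - rewrite !sum_O. lra.
  - rewrite !sum_Sn. eapply Rle_trans; [apply Cmod_triangle|].
    change plus with Rplus. lra.
Qed.

Lemma sum_n_RtoC (x : nat -> R) (N : nat) :
  sum_n (fun n => RtoC (x n)) N = RtoC (sum_n x N).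
Proof.
  induction N as [|N IH].
  - now rewrite !sum_O.
  - rewrite !sum_Sn, IH. symmetry. apply RtoC_plus.
Qed.

Lemma sum_n_fst (u : nat -> C) (N : nat) :
  fst (sum_n u N) = sum_n (fun n => fst (u n)) N.
Proof.
  induction N as [|N IH].
  - now rewrite !sum_O.
  - rewrite !sum_Sn, <- IH. reflexivity.
Qed.

Lemma sum_n_snd (u : nat -> C) (N : nat) :
  snd (sum_n u N) = sum_n (fun n => snd (u n)) N.
Proof.
  induction N as [|N IH].
  - now rewrite !sum_O.
  - rewrite !sum_Sn, <- IH. reflexivity.
Qed.

Lemma Cmod_fst_le (z : C) : Rabs (fst z) <= Cmod z.
Proof. apply Rle_trans with (2 := Rmax_Cmod z). apply Rmax_l. Qed.

Lemma Cmod_snd_le (z : C) : Rabs (snd z) <= Cmod z.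
Proof. apply Rle_trans with (2 := Rmax_Cmod z). apply Rmax_r. Qed.

Lemma Series_finite_support (x : nat -> R) (M : nat) :
  (forall n, (M < n)%nat -> x n = 0) -> Series x = sum_n x M.
Proof.
  intros Hx. apply is_series_unique.
  apply (filterlim_ext_loc (fun _ => sum_n x M)).
  - exists M. intros n Hn. induction Hn as [|n Hn IH]; [reflexivity|].
    rewrite sum_Sn, <- IH, Hx by lia. symmetry. apply Rplus_0_r.
  - apply filterlim_const.
Qed.

Lemma CSeries_finite_support (u : nat -> C) (M : nat) :
  (forall n, (M < n)%nat -> u n = RtoC 0) -> CSeries u = sum_n u M.
Proof.
  intros Hu. unfold CSeries.
  rewrite !(Series_finite_support _ M), <- sum_n_fst, <- sum_n_snd.
  - now destruct (sum_n u M).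
  - intros n Hn. now rewrite Hu.
  - intros n Hn. now rewrite Hu.
Qed.

(** For an absolutely convergent series, the modulus of an affine function of the partial
    sums converges to its value at [CSeries]. *)
Lemma is_lim_seq_Cmod_CSeries (u : nat -> C) (c z : C) :
  ex_series (fun n => Cmod (u n)) ->
  is_lim_seq (fun N => Cmod (c + z * sum_n u N)%C) (Cmod (c + z * CSeries u)%C).
Proof.
  intros Hu.
  assert (H1 : is_lim_seq (fun N => fst (sum_n u N)) (fst (CSeries u))).
  { apply is_lim_seq_ext with (sum_n (fun n => fst (u n))).
    - intros n. now rewrite sum_n_fst.
    - apply (Series_correct (fun n => fst (u n))).
      apply (@ex_series_le R_AbsRing R_CompleteNormedModule _
               (fun n => Cmod (u n))); [|exact Hu].
      intros n. apply Cmod_fst_le. }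
  assert (H2 : is_lim_seq (fun N => snd (sum_n u N)) (snd (CSeries u))).
  { apply is_lim_seq_ext with (sum_n (fun n => snd (u n))).
    - intros n. now rewrite sum_n_snd.
    - apply (Series_correct (fun n => snd (u n))).
      apply (@ex_series_le R_AbsRing R_CompleteNormedModule _
               (fun n => Cmod (u n))); [|exact Hu].
      intros n. apply Cmod_snd_le. }
  unfold Cmod.
  apply (is_lim_seq_continuous sqrt).
  { apply continuity_pt_sqrt.
    apply Rplus_le_le_0_compat; apply pow2_ge_0. }
  set (s := CSeries u) in *.
  cbn [fst snd Cplus Cmult pow].
  repeat first [ apply is_lim_seq_const | exact H1 | exact H2
               | apply is_lim_seq_minus' | apply is_lim_seq_plus'
               | apply is_lim_seq_mult' ].
Qed.

(** * Jacobi recurrences and Wronskians *)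

(** [u] solves the three-term recurrence at the rows [n >= 1]; nothing is required at
    the row [0]. *)
Definition solves (a b : nat -> R) (z : C) (u : nat -> C) : Prop :=
  forall n : nat,
    (b (S n) * u (S (S n)) = (z - a (S n)) * u (S n) - b n * u n)%C.

(** Constant in [n >= 0] when [u] and [v] solve the recurrence at the same point. *)
Definition wronskian (b : nat -> R) (u v : nat -> C) (n : nat) : C :=
  (b n * (u (S n) * v n - u n * v (S n)))%C.

Lemma wronskian_step (a b : nat -> R) (z w : C) (u v : nat -> C) (n : nat) :
  solves a b z u -> solves a b w v ->
  wronskian b u v (S n)
    = (wronskian b u v n + (z - w) * (u (S n) * v (S n)))%C.
Proof.
  intros Hu Hv. unfold wronskian.
  replace (b (S n) * (u (S (S n)) * v (S n) - u (S n) * v (S (S n))))%C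
    with (b (S n) * u (S (S n)) * v (S n) - u (S n) * (b (S n) * v (S (S n))))%C
    by ring.
  rewrite Hu, Hv. ring.
Qed.

(** Christoffel-Darboux formula for solutions with arbitrary initial values. *)
Lemma sum_n_wronskian (a b : nat -> R) (z w : C) (u v : nat -> C) (N : nat) :
  solves a b z u -> solves a b w v ->
  ((z - w) * sum_n (fun n => u n * v n)%C N
     = wronskian b u v N - wronskian b u v 0 + (z - w) * (u 0%nat * v 0%nat))%C.
Proof.
  intros Hu Hv. induction N as [|N IH].
  - rewrite sum_O. ring.
  - rewrite sum_Sn, (wronskian_step a b z w u v N Hu Hv).
    change plus with Cplus. rewrite Cmult_plus_distr_l, IH. ring.
Qed.

Lemma RtoC_neq0 (x : R) : 0 < x -> RtoC x <> RtoC 0.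
Proof. intros Hx E. injection E as E. lra. Qed.

Lemma solves_jacobi_solution (a b : nat -> R) (z u0 u1 : C) :
  (forall n, 0 < b n) -> solves a b z (jacobi_solution a b z u0 u1).
Proof.
  intros hb n. set (u := jacobi_solution a b z u0 u1).
  assert (E : u (S (S n))
    = (((z - a (S n)) * u (S n) - b n * u n) / b (S n))%C) by reflexivity.
  rewrite E. field. apply RtoC_neq0, hb.
Qed.

Lemma solves_poly_p (a b : nat -> R) (z : C) :
  (forall n, 0 < b n) -> solves a b z (fun n => poly_p a b n z).
Proof. intros hb. now apply solves_jacobi_solution. Qed.

Lemma solves_poly_q (a b : nat -> R) (z : C) :
  (forall n, 0 < b n) -> solves a b z (fun n => poly_q a b n z).
Proof. intros hb. now apply solves_jacobi_solution. Qed.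

Lemma poly_p_0 (a b : nat -> R) (z : C) : poly_p a b 0 z = RtoC 1.
Proof. reflexivity. Qed.

Lemma poly_p_1 (a b : nat -> R) (z : C) :
  poly_p a b 1 z = ((z - a 0%nat) / b 0%nat)%C.
Proof. reflexivity. Qed.

(** A solution of all rows, including the row [0], is a multiple of [poly_p]. *)
Lemma jacobi_eigenvector (a b : nat -> R) (z : C) (u : nat -> C) :
  (forall n, 0 < b n) ->
  (forall n, jacobi_apply a b u n = z * u n)%C ->
  forall n, (u n = u 0%nat * poly_p a b n z)%C.
Proof.
  intros hb Hu.
  assert (H : forall n, (u n = u 0%nat * poly_p a b n z)%C /\
                        (u (S n) = u 0%nat * poly_p a b (S n) z)%C).
  { induction n as [|n [IH1 IH2]].
    - split.
      + rewrite poly_p_0. ring.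
      + assert (hb0 := RtoC_neq0 _ (hb 0%nat)).
        rewrite poly_p_1. specialize (Hu 0%nat). cbn [jacobi_apply] in Hu.
        replace (u 1%nat) with (b 0%nat * u 1%nat / b 0%nat)%C by (field; exact hb0).
        replace (b 0%nat * u 1%nat)%C
          with (a 0%nat * u 0%nat + b 0%nat * u 1%nat - a 0%nat * u 0%nat)%C by ring.
        rewrite Hu. field. exact hb0.
    - split; [exact IH2|].
      assert (hbn := RtoC_neq0 _ (hb (S n))).
      specialize (Hu (S n)). cbn [jacobi_apply] in Hu.
      assert (Hp := solves_poly_p a b z hb n). cbn beta in Hp.
      replace (u (S (S n))) with (b (S n) * u (S (S n)) / b (S n))%C
        by (field; exact hbn).
      replace (b (S n) * u (S (S n)))%C
        with (b n * u n + a (S n) * u (S n) + b (S n) * u (S (S n))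
              - (b n * u n + a (S n) * u (S n)))%C by ring.
      rewrite Hu, IH1, IH2.
      replace (poly_p a b (S (S n)) z)
        with (b (S n) * poly_p a b (S (S n)) z / b (S n))%C by (field; exact hbn).
      rewrite Hp. field. exact hbn. }
  intros n. apply H.
Qed.

Lemma Cconj_RtoC (x : R) : Cconj (RtoC x) = RtoC x.
Proof. unfold Cconj, RtoC; cbn; f_equal; ring. Qed.

Lemma Cconj_Ci_mult (y : R) : Cconj (Ci * y) = (- (Ci * y))%C.
Proof. unfold Cconj, Ci, Cmult, Copp, RtoC; cbn; f_equal; ring. Qed.

Lemma poly_p_conj (a b : nat -> R) (z : C) (n : nat) :
  (forall n, 0 < b n) ->
  Cconj (poly_p a b n z) = poly_p a b n (Cconj z).
Proof.
  intros hb.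
  rewrite (jacobi_eigenvector a b (Cconj z) (fun n => Cconj (poly_p a b n z)) hb).
  - rewrite poly_p_0, Cconj_RtoC. ring.
  - intros m. destruct m as [|m]; cbn [jacobi_apply].
    + rewrite poly_p_0, poly_p_1, Cconj_RtoC, Cdiv_conj, Cminus_conj, !Cconj_RtoC
        by apply RtoC_neq0, hb.
      field. apply RtoC_neq0, hb.
    + rewrite <- (Cconj_RtoC (b m)), <- (Cconj_RtoC (b (S m))), <- (Cconj_RtoC (a (S m))).
      rewrite <- !Cmult_conj, <- !Cplus_conj. f_equal.
      rewrite (solves_poly_p a b z hb m). ring.
Qed.

Lemma poly_q_0_real (a b : nat -> R) (n : nat) :
  (forall n, 0 < b n) -> Cconj (poly_q a b n 0) = poly_q a b n 0.
Proof.
  intros hb.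
  assert (H : Cconj (poly_q a b n 0) = poly_q a b n 0 /\
              Cconj (poly_q a b (S n) 0) = poly_q a b (S n) 0).
  { induction n as [|n [IH1 IH2]].
    - cbn. rewrite Cdiv_conj, !Cconj_RtoC by apply RtoC_neq0, hb. auto.
    - split; [exact IH2|].
      assert (E : poly_q a b (S (S n)) 0
        = (((0 - a (S n)) * poly_q a b (S n) 0 - b n * poly_q a b n 0) / b (S n))%C)
        by reflexivity.
      rewrite E, Cdiv_conj by apply RtoC_neq0, hb.
      now rewrite Cminus_conj, !Cmult_conj, Cminus_conj, !Cconj_RtoC, IH1, IH2. }
  apply H.
Qed.

Lemma wronskian_poly_p (a b : nat -> R) (z w : C) (N : nat) :
  (forall n, 0 < b n) ->
  wronskian b (fun n => poly_p a b n z) (fun n => poly_p a b n w) N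
    = ((z - w) * sum_n (fun n => poly_p a b n z * poly_p a b n w)%C N)%C.
Proof.
  intros hb.
  rewrite (sum_n_wronskian a b z w) by now apply solves_poly_p.
  unfold wronskian at 3. rewrite !poly_p_0, !poly_p_1.
  field. apply RtoC_neq0, hb.
Qed.

(** The right-hand side at [w = 0] is the [N]-th partial sum of [nevanlinna_B]. *)
Lemma wronskian_poly_p_q (a b : nat -> R) (z w : C) (N : nat) :
  (forall n, 0 < b n) ->
  wronskian b (fun n => poly_p a b n z) (fun n => poly_q a b n w) N
    = (- (1) + (z - w) * sum_n (fun n => poly_q a b n w * poly_p a b n z)%C N)%C.
Proof.
  intros hb.
  rewrite (sum_n_ext _ (fun n => poly_p a b n z * poly_q a b n w)%C)
    by (intros; apply Cmult_comm).
  rewrite (sum_n_wronskian a b z w)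
    by (apply solves_poly_p || apply solves_poly_q; exact hb).
  unfold wronskian at 3. rewrite !poly_p_0, !poly_p_1. cbn [poly_q jacobi_solution].
  unfold poly_q; cbn [jacobi_solution].
  field. apply RtoC_neq0, hb.
Qed.

(** * Growth of the kernel along the imaginary axis *)

(** The partial sum over [n <= N] of the reproducing kernel [sum |p_n(z)|^2] on the
    diagonal; its first term is [1]. *)
Definition kernel (a b : nat -> R) (z : C) (N : nat) : R :=
  sum_n (fun n => Cmod (poly_p a b n z) ^ 2) N.

Lemma kernel_S (a b : nat -> R) (z : C) (N : nat) :
  kernel a b z (S N) = kernel a b z N + Cmod (poly_p a b (S N) z) ^ 2.
Proof. unfold kernel. now rewrite sum_Sn. Qed.

Lemma kernel_0 (a b : nat -> R) (z : C) : kernel a b z 0 = 1.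
Proof. unfold kernel. rewrite sum_O, poly_p_0, Cmod_1. ring. Qed.

Lemma kernel_mono (a b : nat -> R) (z : C) (N M : nat) :
  (N <= M)%nat -> kernel a b z N <= kernel a b z M.
Proof.
  intros H. induction H as [|M H IH]; [lra|].
  rewrite kernel_S. assert (H0 := pow2_ge_0 (Cmod (poly_p a b (S M) z))). lra.
Qed.

Lemma kernel_ge_1 (a b : nat -> R) (z : C) (N : nat) : 1 <= kernel a b z N.
Proof. rewrite <- (kernel_0 a b z). apply kernel_mono. lia. Qed.

Lemma wronskian_poly_p_conj (a b : nat -> R) (y : R) (N : nat) :
  (forall n, 0 < b n) ->
  wronskian b (fun n => poly_p a b n (Ci * y)) (fun n => poly_p a b n (- (Ci * y))) N
    = (RtoC (2 * y * kernel a b (Ci * y) N) * Ci)%C.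
Proof.
  intros hb. rewrite wronskian_poly_p by exact hb.
  unfold kernel.
  rewrite (sum_n_ext (fun n => poly_p a b n (Ci * y) * poly_p a b n (- (Ci * y)))%C
    (fun n => RtoC (Cmod (poly_p a b n (Ci * y)) ^ 2))).
  - rewrite sum_n_RtoC, !RtoC_mult. ring.
  - intros n. now rewrite Cmod2_conj, poly_p_conj, Cconj_Ci_mult.
Qed.

Lemma Cmod_poly_p_opp (a b : nat -> R) (y : R) (n : nat) :
  (forall n, 0 < b n) ->
  Cmod (poly_p a b n (- (Ci * y))) = Cmod (poly_p a b n (Ci * y)).
Proof.
  intros hb.
  rewrite <- Cconj_Ci_mult, <- poly_p_conj by exact hb. apply Cmod_conj.
Qed.

Lemma Cmod_RtoC_Ci (x : R) : Cmod (RtoC x * Ci) = Rabs x.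
Proof. rewrite Cmod_mult, Cmod_R, Cmod_Ci. ring. Qed.

Lemma kernel_le_Cmod_poly_p (a b : nat -> R) (y : R) (N : nat) :
  (forall n, 0 < b n) -> 0 < y ->
  y * kernel a b (Ci * y) N
    <= b N * (Cmod (poly_p a b N (Ci * y)) * Cmod (poly_p a b (S N) (Ci * y))).
Proof.
  intros hb hy.
  assert (HK := kernel_ge_1 a b (Ci * y) N).
  assert (HW := f_equal Cmod (wronskian_poly_p_conj a b y N hb)).
  rewrite Cmod_RtoC_Ci, Rabs_pos_eq in HW by nra.
  unfold wronskian in HW.
  rewrite Cmod_mult, Cmod_R, (Rabs_pos_eq (b N)) in HW by (left; apply hb).
  set (p := poly_p a b N (Ci * y)) in *.
  set (p' := poly_p a b (S N) (Ci * y)) in *.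
  assert (Ht := Cmod_triangle (p' * poly_p a b N (- (Ci * y)))
                  (- (p * poly_p a b (S N) (- (Ci * y))))).
  rewrite Cmod_opp, !Cmod_mult, !Cmod_poly_p_opp in Ht by exact hb.
  fold p in Ht. fold p' in Ht.
  apply (Rmult_le_compat_l (b N)) in Ht; [|left; apply hb].
  unfold Cminus in HW. rewrite HW in Ht. nra.
Qed.

Lemma one_minus_div_le_ln (x y : R) :
  0 < x -> 0 < y -> 1 - x / y <= ln y - ln x.
Proof.
  intros Hx Hy.
  assert (H := exp_ineq1_le (ln x - ln y)).
  unfold Rminus in H. rewrite exp_plus, exp_Ropp, !exp_ln in H by assumption.
  unfold Rdiv. lra.
Qed.

(** A large last step [F2 - F1] enters the conclusion only through a logarithm; the
    assumption [x <= 1] compensates for this. *)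
Lemma log_increment_bound (F0 F1 F2 x : R) :
  0 < F0 -> F0 <= F1 -> F1 <= F2 -> x <= 1 ->
  x * F1 <= ((F1 - F0) + (F2 - F1)) / 2 ->
  x <= (ln F1 - ln F0) + 2 * (ln F2 - ln F1).
Proof.
  intros H0 H1 H2 Hx HxF.
  assert (L1 := one_minus_div_le_ln F0 F1 H0 ltac:(lra)).
  assert (L2 := one_minus_div_le_ln F1 F2 ltac:(lra) ltac:(lra)).
  assert (E0 : F0 / F1 * F1 = F0) by (field; lra).
  assert (E1 : F1 / F2 * F2 = F1) by (field; lra).
  set (s := F0 / F1) in *. set (t := F1 / F2) in *.
  assert (Hs : s <= 1) by nra.
  assert (Ht : t <= 1) by nra.
  assert (Ht0 : 0 < t) by (apply Rdiv_lt_0_compat; lra).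
  destruct (Rle_dec F2 (2 * F1)) as [Hc|Hc].
  (* Moderate last step: [x] is controlled by the difference quotients. *)
  - assert (Hxs : x <= ((1 - s) + (F2 - F1) / F1) / 2).
    { apply Rmult_le_reg_r with F1; [lra|].
      replace (((1 - s) + (F2 - F1) / F1) / 2 * F1)
        with ((F1 - s * F1 + (F2 - F1)) / 2) by (field; lra).
      rewrite E0. exact HxF. }
    assert (Hr : (F2 - F1) / F1 <= 4 * (1 - t)).
    { apply Rmult_le_reg_r with F1; [lra|].
      replace ((F2 - F1) / F1 * F1) with (F2 - F1) by (field; lra).
      nra. }
    lra.
  (* Large last step: twice the last logarithm is at least [2 (1 - t) >= 1 >= x]. *)
  - assert (t <= / 2) by nra. lra.
Qed.

Lemma sum_n_inv_le_ln_kernel (a b : nat -> R) (y : R) (m K : nat) :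
  (forall n, 0 < b n) -> 0 < y -> (forall k, y <= b (S m + k)%nat) ->
  y * sum_n (fun k => / b (S m + k)%nat) K
    <= 3 * ln (kernel a b (Ci * y) (S (S m + K))).
Proof.
  intros hb hy hy'.
  set (F := kernel a b (Ci * y)).
  assert (HF1 : forall n, 1 <= F n) by (intros; apply kernel_ge_1).
  assert (HFm : forall n, F n <= F (S n)) by (intros; apply kernel_mono; lia).
  assert (Hstep : forall k, y * / b (S m + k)%nat
    <= (ln (F (S m + k)%nat) - ln (F (m + k)%nat))
       + 2 * (ln (F (S (S m + k))) - ln (F (S m + k)%nat))).
  { intros k. specialize (hy' k).
    assert (HC := kernel_le_Cmod_poly_p a b y (S m + k) hb hy). fold F in HC.
    cbn [Nat.add] in *.
    assert (K1 := kernel_S a b (Ci * y) (m + k)). fold F in K1.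
    assert (K2 := kernel_S a b (Ci * y) (S (m + k))). fold F in K2.
    assert (hbk := hb (S (m + k))).
    apply log_increment_bound; auto.
    - specialize (HF1 (m + k)%nat). lra.
    - apply Rmult_le_reg_r with (1 := hbk).
      rewrite Rmult_assoc, Rinv_l, Rmult_1_r, Rmult_1_l by lra. exact hy'.
    - revert HC K1 K2.
      generalize (Cmod (poly_p a b (S (m + k)) (Ci * y)))
        (Cmod (poly_p a b (S (S (m + k))) (Ci * y))).
      intros s t HC K1 K2.
      assert (H : y * / b (S (m + k)) * F (S (m + k)) <= s * t).
      { apply Rmult_le_reg_l with (1 := hbk).
        replace (b (S (m + k)) * (y * / b (S (m + k)) * F (S (m + k))))
          with (y * F (S (m + k))) by (field; lra).
        exact HC. }
      assert (H2 := pow2_ge_0 (s - t)). nra. }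
  assert (Hsum : y * sum_n (fun k => / b (S m + k)%nat) K
    <= (ln (F (S m + K)%nat) - ln (F m))
       + 2 * (ln (F (S (S m + K))) - ln (F (S m)))).
  { induction K as [|K IH].
    - rewrite sum_O. specialize (Hstep 0%nat).
      rewrite !Nat.add_0_r in *. exact Hstep.
    - rewrite sum_Sn. change plus with Rplus.
      specialize (Hstep (S K)). rewrite !Nat.add_succ_r in *.
      cbn [Nat.add] in *. lra. }
  assert (L0 : forall n, 0 <= ln (F n))
    by (intros n; rewrite <- ln_1; apply ln_le; [lra | apply HF1]).
  assert (L1 : ln (F (S m + K)%nat) <= ln (F (S (S m + K)))).
  { apply ln_le; [specialize (HF1 (S m + K)%nat); lra | apply HFm]. }
  assert (L2 := L0 m). assert (L3 := L0 (S m)). lra.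
Qed.

Lemma wronskian_plucker (b : nat -> R) (u v f g : nat -> C) (n : nat) :
  (wronskian b u f n * wronskian b v g n - wronskian b v f n * wronskian b u g n
    = wronskian b u v n * wronskian b f g n)%C.
Proof. unfold wronskian. ring. Qed.

Lemma wronskian_conj (b : nat -> R) (u v u' v' : nat -> C) (n : nat) :
  (forall k, Cconj (u k) = u' k) -> (forall k, Cconj (v k) = v' k) ->
  Cconj (wronskian b u v n) = wronskian b u' v' n.
Proof.
  intros Hu Hv. unfold wronskian.
  rewrite Cmult_conj, Cminus_conj, !Cmult_conj, !Hu, !Hv.
  now rewrite Cconj_RtoC.
Qed.

(** The Wronskian on the right is the [N]-th partial sum of [nevanlinna_B]
    ([wronskian_poly_p_q]). *)
Lemma kernel_le_wronskian_p_q (a b : nat -> R) (y : R) (N : nat) :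
  (forall n, 0 < b n) -> 0 < y ->
  kernel a b (Ci * y) N
    <= kernel a b 0 N
       * Cmod (wronskian b (fun n => poly_p a b n (Ci * y))
                           (fun n => poly_q a b n 0) N) ^ 2.
Proof.
  intros hb hy.
  set (p := fun n => poly_p a b n (Ci * y)).
  set (p' := fun n => poly_p a b n (- (Ci * y))).
  set (p0 := fun n => poly_p a b n 0).
  set (q0 := fun n => poly_q a b n 0).
  assert (Hp : forall k, Cconj (p k) = p' k)
    by (intros k; unfold p, p'; rewrite poly_p_conj by exact hb;
        now rewrite Cconj_Ci_mult).
  assert (Hp0 : forall k, Cconj (p0 k) = p0 k)
    by (intros k; unfold p0; rewrite poly_p_conj by exact hb; now rewrite Cconj_RtoC).
  assert (Hq0 : forall k, Cconj (q0 k) = q0 k)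
    by (intros k; now apply poly_q_0_real).
  set (B := wronskian b p q0 N).
  set (D := wronskian b p p0 N).
  assert (HB : Cmod (wronskian b p' q0 N) = Cmod B)
    by (rewrite <- (wronskian_conj b p q0 p' q0 N Hp Hq0); apply Cmod_conj).
  assert (HD : Cmod (wronskian b p' p0 N) = Cmod D)
    by (rewrite <- (wronskian_conj b p p0 p' p0 N Hp Hp0); apply Cmod_conj).
  assert (H1 : wronskian b p0 q0 N = (- (1))%C).
  { unfold p0, q0. rewrite wronskian_poly_p_q by exact hb. ring. }
  assert (HF := kernel_ge_1 a b (Ci * y) N).
  assert (HP := kernel_ge_1 a b 0 N).
  assert (HE : y * kernel a b (Ci * y) N <= Cmod D * Cmod B).
  { assert (H := f_equal Cmod (wronskian_plucker b p p' p0 q0 N)).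
    fold B D in H.
    rewrite H1, Cmod_mult, Cmod_opp, Cmod_1, Rmult_1_r in H.
    rewrite (wronskian_poly_p_conj a b y N hb : wronskian b p p' N = _),
      Cmod_RtoC_Ci, Rabs_pos_eq in H by (auto || nra).
    assert (Ht := Cmod_triangle (D * wronskian b p' q0 N)
                    (- (wronskian b p' p0 N * B))).
    rewrite Cmod_opp, !Cmod_mult, HB, HD in Ht.
    unfold Cminus in H. rewrite H in Ht. lra. }
  assert (HD2 : Cmod D ^ 2 <= y ^ 2 * (kernel a b (Ci * y) N * kernel a b 0 N)).
  { unfold D, p, p0. rewrite wronskian_poly_p by exact hb.
    replace (Ci * y - 0)%C with (RtoC y * Ci)%C by ring.
    rewrite Cmod_mult, Cmod_RtoC_Ci, Rabs_pos_eq, Rpow_mult_distr by lra.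
    apply Rmult_le_compat_l; [apply pow2_ge_0|].
    eapply Rle_trans; [|apply sum_n_Cauchy_Schwarz].
    apply pow_incr. split; [apply Cmod_ge_0|].
    eapply Rle_trans; [apply sum_n_Cmod_le|]. right.
    apply sum_n_ext. intros n. apply Cmod_mult. }
  assert (HB0 := Cmod_ge_0 B). assert (HD0 := Cmod_ge_0 D).
  revert HE HD2 HF HP HB0 HD0. clearbody B D. clear - hy.
  generalize (kernel a b (Ci * y) N) (kernel a b 0 N) (Cmod B) (Cmod D).
  intros F P s t HE HD2 HF HP Hs Ht.
  assert (H1 : (y * F) ^ 2 <= (t * s) ^ 2) by (apply pow_incr; nra).
  assert (H2 : t ^ 2 * s ^ 2 <= y ^ 2 * (F * P) * s ^ 2)
    by (apply Rmult_le_compat_r; [apply pow2_ge_0 | exact HD2]).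
  apply Rmult_le_reg_l with (y ^ 2 * F); [|nra].
  apply Rmult_lt_0_compat; [apply pow_lt|]; lra.
Qed.

(** * Square summability in limit circle case *)

Lemma CSeries_inner_finite (u v : nat -> C) (M : nat) :
  (forall n, (M < n)%nat -> u n = RtoC 0) ->
  inner u v = sum_n (fun n => u n * Cconj (v n))%C M.
Proof.
  intros Hu. apply CSeries_finite_support. intros n Hn. rewrite Hu by exact Hn. ring.
Qed.

Lemma jacobi_green (a b : nat -> R) (u v : nat -> C) (N : nat) :
  sum_n (fun n => jacobi_apply a b u n * v n)%C N
    = (sum_n (fun n => u n * jacobi_apply a b v n)%C N + wronskian b u v N)%C :> C.
Proof.
  induction N as [|N IH].
  - rewrite !sum_O. unfold wronskian. cbn [jacobi_apply]. ring.
  - rewrite !sum_Sn, IH. change plus with Cplus. unfold wronskian.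
    cbn [jacobi_apply]. ring.
Qed.

Lemma ell2_finite (u : nat -> C) (M : nat) :
  (forall n, (M < n)%nat -> u n = RtoC 0) -> ell2 u.
Proof.
  intros Hu. exists (sum_n (fun n => Cmod (u n) ^ 2) M).
  apply (filterlim_ext_loc (fun _ => sum_n (fun n => Cmod (u n) ^ 2) M)).
  - exists M. intros n Hn. induction Hn as [|n Hn IH]; [reflexivity|].
    rewrite sum_Sn, <- IH, Hu, Cmod_0, pow_i by lia. symmetry. apply Rplus_0_r.
  - apply filterlim_const.
Qed.

Lemma l2dist_diag (u : nat -> C) : l2dist u u = 0.
Proof.
  unfold l2dist. rewrite (Series_ext _ (fun _ => 0 * 0)).
  - rewrite Series_scal_l, Rmult_0_l. apply sqrt_0.
  - intros n. replace (u n - u n)%C with (RtoC 0) by ring. rewrite Cmod_0. ring.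
Qed.

Lemma jacobi_min_finite (a b : nat -> R) (u : nat -> C) (M : nat) :
  (forall n, (M < n)%nat -> u n = RtoC 0) ->
  jacobi_min a b u (jacobi_apply a b u).
Proof.
  intros Hu.
  assert (Hf : forall n, (S M < n)%nat -> jacobi_apply a b u n = RtoC 0).
  { intros [|n] Hn; [lia|]. cbn [jacobi_apply].
    rewrite !Hu by lia. ring. }
  split; [now apply ell2_finite with M|].
  split; [now apply ell2_finite with (S M)|].
  intros eps He. exists u, (jacobi_apply a b u).
  rewrite !l2dist_diag. repeat split; auto.
  exists (S M). intros n Hn. apply Hu. lia.
Qed.

Lemma sum_n_unit_vector (m : nat) (v : nat -> C) (N : nat) :
  (m <= N)%nat ->
  sum_n (fun n => (if Nat.eqb n m then RtoC 1 else RtoC 0) * v n)%C N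
    = v m :> C.
Proof.
  assert (H : forall N, sum_n (fun n => (if Nat.eqb n m then RtoC 1 else RtoC 0) * v n)%C N
    = (if Nat.leb m N then v m else RtoC 0) :> C).
  { clear N. induction N as [|N IH].
    - rewrite sum_O. destruct m as [|m]; cbn; ring.
    - rewrite sum_Sn, IH. change plus with Cplus.
      destruct (Nat.eqb_spec (S N) m) as [E|E].
      + rewrite (proj2 (Nat.leb_gt m N)), (proj2 (Nat.leb_le m (S N))) by lia.
        subst m. ring.
      + destruct (Nat.leb_spec m N), (Nat.leb_spec m (S N)); try lia; ring. }
  intros Hm. rewrite H. apply Nat.leb_le in Hm. now rewrite Hm.
Qed.

(** The conjugate of a deficiency vector is an eigenvector of the full Jacobi matrix, the
    row [0] included: pair with the unit vectors. *)
Lemma deficiency_space_jacobi (a b : nat -> R) (z : C) (v : nat -> C) :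
  deficiency_space (jacobi_min a b) z v ->
  forall m, jacobi_apply a b (fun n => Cconj (v n)) m = (Cconj z * Cconj (v m))%C.
Proof.
  intros (_ & _ & Hadj) m.
  set (u := fun n => if Nat.eqb n m then RtoC 1 else RtoC 0).
  assert (Hu : forall n, (m < n)%nat -> u n = RtoC 0).
  { intros n Hn. unfold u. now rewrite (proj2 (Nat.eqb_neq n m)) by lia. }
  specialize (Hadj _ _ (jacobi_min_finite a b u m Hu)).
  rewrite (CSeries_inner_finite _ v (S m)) in Hadj.
  2:{ intros [|n] Hn; [lia|]. cbn [jacobi_apply]. rewrite !Hu by lia. ring. }
  rewrite (CSeries_inner_finite _ _ (S m)) in Hadj by (intros; apply Hu; lia).
  rewrite (jacobi_green a b u (fun n => Cconj (v n))) in Hadj.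
  unfold wronskian in Hadj. rewrite !Hu in Hadj by lia.
  unfold u in Hadj. rewrite !sum_n_unit_vector in Hadj by lia.
  rewrite Cmult_conj in Hadj. rewrite <- Hadj. ring.
Qed.

Lemma limit_circle_poly_p_Ci (a b : nat -> R) :
  (forall n, 0 < b n) -> limit_circle a b ->
  ex_series (fun n => Cmod (poly_p a b n (Ci * RtoC 1)) ^ 2).
Proof.
  intros hb [_ [[e [He [Hind _]]] _]].
  specialize (He 1%nat ltac:(lia)). set (v := e 1%nat) in *.
  set (w := fun n => Cconj (v n)).
  assert (Hw : forall n, w n = (w 0%nat * poly_p a b n (- (Ci * RtoC 1)))%C).
  { apply jacobi_eigenvector; [exact hb|]. intros n.
    unfold w. rewrite (deficiency_space_jacobi a b Ci v He n).
    rewrite <- Cconj_Ci_mult, Cmult_1_r. reflexivity. }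
  assert (Hw0 : 0 < Cmod (w 0%nat)).
  { apply Cmod_gt_0. intros E.
    assert (H1 : RtoC 1 = RtoC 0).
    { apply (Hind (fun _ => RtoC 1)) with (i := 1%nat); [|lia].
      intros n. rewrite sum_n_n. fold v.
      rewrite <- (Cconj_conj (v n)). change (Cconj (v n)) with (w n).
      rewrite Hw, E, Cmult_0_l, Cconj_RtoC. apply Cmult_0_r. }
    injection H1 as H1. lra. }
  destruct He as [Hl _].
  apply (ex_series_ext (fun n => / Cmod (w 0%nat) ^ 2 * Cmod (v n) ^ 2)).
  - intros n. rewrite <- (Cmod_poly_p_opp a b 1 n hb), <- (Cmod_conj (v n)).
    change (Cconj (v n)) with (w n). rewrite (Hw n), Cmod_mult.
    match goal with |- ?l = ?r => change (@eq R l r) end. field. lra.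
  - apply (ex_series_scal (/ Cmod (w 0%nat) ^ 2) (fun n => Cmod (v n) ^ 2)), Hl.
Qed.

(** All solutions at an arbitrary point [z] are dominated by [poly_p] at [i]: by
    [wronskian_plucker] the Wronskians of a solution with [poly_p] at [i] and [-i]
    recover that solution, and a Gronwall argument bounds them. *)
Lemma solution_dominated (a b : nat -> R) (z : C) (u : nat -> C) :
  (forall n, 0 < b n) ->
  ex_series (fun n => Cmod (poly_p a b n (Ci * RtoC 1)) ^ 2) ->
  solves a b z u ->
  exists K : R, 0 <= K /\
    forall n, Cmod (u n) <= K * Cmod (poly_p a b n (Ci * RtoC 1)).
Proof.
  intros hb HX Hu.
  set (w := (Ci * RtoC 1)%C) in *.
  set (p := fun n => poly_p a b n w).
  set (p' := fun n => poly_p a b n (- w)).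
  set (x := fun n => Cmod (p n)).
  assert (Hp' : forall n, Cmod (p' n) = x n) by (intros; now apply Cmod_poly_p_opp).
  set (s := fun n => Cmod (wronskian b u p n) + Cmod (wronskian b u p' n)).
  assert (Hs0 : forall n, 0 <= s n)
    by (intros; apply Rplus_le_le_0_compat; apply Cmod_ge_0).
  assert (Hx0 : forall n, 0 <= x n) by (intros; apply Cmod_ge_0).
  assert (HW : forall n, 2 <= Cmod (wronskian b p p' n)).
  { intros n. unfold p, p', w. rewrite wronskian_poly_p_conj, Cmod_RtoC_Ci by exact hb.
    assert (HK := kernel_ge_1 a b (Ci * RtoC 1) n). rewrite Rabs_pos_eq; lra. }
  assert (Hbound : forall n m f,
    (f * wronskian b p p' n = p m * wronskian b u p' n - p' m * wronskian b u p n)%C ->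
    Cmod f <= s n / 2 * x m).
  { intros n m f E. apply (f_equal Cmod) in E. rewrite Cmod_mult in E.
    assert (Ht := Cmod_triangle (p m * wronskian b u p' n)
                    (- (p' m * wronskian b u p n))).
    unfold Cminus in E. rewrite <- E, Cmod_opp, !Cmod_mult, Hp' in Ht.
    change (Cmod (p m)) with (x m) in Ht.
    specialize (HW n). assert (H0 := Cmod_ge_0 f). unfold s. nra. }
  assert (Hn : forall n, Cmod (u n) <= s n / 2 * x n).
  { intros n. apply Hbound. unfold wronskian. ring. }
  assert (HSn : forall n, Cmod (u (S n)) <= s n / 2 * x (S n)).
  { intros n. apply Hbound. unfold wronskian. ring. }
  set (M := Cmod (z - w) + Cmod (z - - w)).
  assert (HM : 0 <= M) by (apply Rplus_le_le_0_compat; apply Cmod_ge_0).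
  assert (Hstep : forall n, s (S n) <= s n * (1 + M * x (S n) ^ 2)).
  { intros n.
    assert (E1 : Cmod (wronskian b u p (S n))
      <= Cmod (wronskian b u p n) + Cmod (z - w) * (Cmod (u (S n)) * x (S n))).
    { rewrite (wronskian_step a b z w) by (auto; now apply solves_poly_p).
      eapply Rle_trans; [apply Cmod_triangle|]. rewrite !Cmod_mult. right. reflexivity. }
    assert (E2 : Cmod (wronskian b u p' (S n))
      <= Cmod (wronskian b u p' n) + Cmod (z - - w) * (Cmod (u (S n)) * x (S n))).
    { rewrite (wronskian_step a b z (- w)) by (auto; now apply solves_poly_p).
      eapply Rle_trans; [apply Cmod_triangle|]. rewrite !Cmod_mult, Hp'.
      right. reflexivity. }
    assert (E3 : Cmod (u (S n)) * x (S n) <= s n * x (S n) ^ 2).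
    { specialize (HSn n). specialize (Hx0 (S n)). specialize (Hs0 n).
      assert (0 <= s n * x (S n)) by nra. nra. }
    assert (E4 : M * (Cmod (u (S n)) * x (S n)) <= M * (s n * x (S n) ^ 2))
      by (apply Rmult_le_compat_l; auto).
    unfold M in *. unfold s at 1. unfold s at 1 in E4. unfold s at 1. nra. }
  assert (Hexp : forall n, s n <= s 0%nat * exp (M * sum_n (fun k => x k ^ 2) n)).
  { induction n as [|n IH].
    - rewrite sum_O. assert (H := exp_ineq1_le (M * x 0%nat ^ 2)).
      specialize (Hs0 0%nat). assert (0 <= M * x 0%nat ^ 2)
        by (apply Rmult_le_pos; [auto | apply pow2_ge_0]). nra.
    - rewrite sum_Sn. change plus with Rplus.
      rewrite Rmult_plus_distr_l, exp_plus, <- Rmult_assoc.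
      eapply Rle_trans; [apply Hstep|].
      apply Rmult_le_compat; auto.
      + assert (0 <= M * x (S n) ^ 2)
          by (apply Rmult_le_pos; [auto | apply pow2_ge_0]). lra.
      + apply exp_ineq1_le. }
  exists (s 0%nat * exp (M * Series (fun k => x k ^ 2)) / 2). split.
  - specialize (Hs0 0%nat). assert (H := exp_pos (M * Series (fun k => x k ^ 2))). nra.
  - intros n. eapply Rle_trans; [apply Hn|].
    change (Cmod (poly_p a b n w)) with (x n).
    apply Rmult_le_compat_r; [apply Hx0|].
    apply Rmult_le_compat_r; [lra|].
    eapply Rle_trans; [apply Hexp|].
    apply Rmult_le_compat_l; [apply Hs0|].
    assert (HXn : M * sum_n (fun k => x k ^ 2) n <= M * Series (fun k => x k ^ 2)).
    { apply Rmult_le_compat_l; [exact HM|].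
      apply sum_n_le_Series; [intros; apply pow2_ge_0 | exact HX]. }
    destruct HXn as [Hlt|Heq]; [left; now apply exp_increasing | rewrite Heq; lra].
Qed.

Lemma ex_series_mult_dominated (x u v : nat -> R) (K L : R) :
  ex_series (fun n => x n ^ 2) ->
  (forall n, 0 <= u n <= K * x n) -> (forall n, 0 <= v n <= L * x n) ->
  ex_series (fun n => u n * v n).
Proof.
  intros Hx Hu Hv.
  apply (@ex_series_le R_AbsRing R_CompleteNormedModule _ (fun n => (K * L) * x n ^ 2)).
  - intros n. specialize (Hu n). specialize (Hv n).
    change (Rabs (u n * v n) <= K * L * x n ^ 2). rewrite Rabs_pos_eq by nra.
    replace (K * L * x n ^ 2) with ((K * x n) * (L * x n)) by ring.
    apply Rmult_le_compat; lra.
  - apply (ex_series_scal (K * L) (fun n => x n ^ 2)), Hx.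
Qed.

(** The bound [1 <= b_n |p_n(i)| |p_(n+1)(i)|] makes [1 / b_n] summable. *)
Lemma ex_series_inv_b (a b : nat -> R) :
  (forall n, 0 < b n) ->
  ex_series (fun n => Cmod (poly_p a b n (Ci * RtoC 1)) ^ 2) ->
  ex_series (fun n => / b n).
Proof.
  intros hb HX. set (x := fun n => Cmod (poly_p a b n (Ci * RtoC 1))) in *.
  apply (@ex_series_le R_AbsRing R_CompleteNormedModule _
           (fun n => x n ^ 2 + x (S n) ^ 2)).
  - intros n. specialize (hb n) as hbn.
    change (Rabs (/ b n) <= x n ^ 2 + x (S n) ^ 2).
    rewrite Rabs_pos_eq by (left; now apply Rinv_0_lt_compat).
    assert (HC := kernel_le_Cmod_poly_p a b 1 n hb Rlt_0_1).
    assert (HK := kernel_ge_1 a b (Ci * RtoC 1) n).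
    change (1 * kernel a b (Ci * RtoC 1) n <= b n * (x n * x (S n))) in HC.
    apply Rmult_le_reg_l with (1 := hbn). rewrite Rinv_r by lra.
    assert (H2 := pow2_ge_0 (x n - x (S n))).
    assert (0 <= x n) by apply Cmod_ge_0. assert (0 <= x (S n)) by apply Cmod_ge_0.
    apply Rle_trans with (b n * (x n * x (S n))); [lra|].
    apply Rmult_le_compat_l; [lra|]. nra.
  - apply (ex_series_plus (fun n => x n ^ 2) (fun n => x (S n) ^ 2)); [exact HX|].
    now apply (ex_series_incr_1 (fun n => x n ^ 2)).
Qed.

(** * The lower bound *)

(** As [1 / b_n] is summable, [b_n] tends to infinity and the maximum defining [h(r)]
    exists once its index set contains [1]. *)
Lemma is_h_exists (b : nat -> R) (r : R) :
  (forall n, 0 < b n) -> ex_series (fun n => / b n) -> b 1%nat < r ->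
  exists m, is_h b r (S m) /\ forall k, r <= b (S m + k)%nat.
Proof.
  intros hb Hs Hr.
  assert (hr : 0 < r) by (specialize (hb 1%nat); lra).
  assert (HN : exists N, forall n, (N <= n)%nat -> r <= b n).
  { assert (Hl := ex_series_lim_0 _ Hs). apply is_lim_seq_spec in Hl.
    destruct (Hl (mkposreal _ (Rinv_0_lt_compat _ hr))) as [N HN].
    exists N. intros n Hn. specialize (HN n Hn). cbn in HN. specialize (hb n).
    rewrite Rminus_0_r, Rabs_pos_eq in HN by (left; now apply Rinv_0_lt_compat).
    left. rewrite <- (Rinv_inv r), <- (Rinv_inv (b n)).
    apply Rinv_lt_contravar; [|exact HN].
    apply Rmult_lt_0_compat; now apply Rinv_0_lt_compat. }
  destruct HN as [N HN].
  assert (Hmax : exists m, is_max (fun n => (1 <= n)%nat /\ b n < r) m).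
  { induction N as [|N IH].
    - specialize (HN 1%nat ltac:(lia)). lra.
    - destruct (Rlt_dec (b N) r) as [HbN|HbN].
      + destruct (Nat.eq_dec N 0) as [E|E].
        * specialize (HN 1%nat ltac:(lia)). lra.
        * exists N. split; [split; [lia | exact HbN]|].
          intros n [_ Hn]. destruct (Nat.le_gt_cases n N) as [|Hlt]; [assumption|].
          specialize (HN n Hlt). lra.
      + apply IH. intros n Hn. destruct (Nat.eq_dec n N) as [->|E]; [lra|].
        apply HN. lia. }
  destruct Hmax as [m Hm]. exists m. split.
  - now exists m.
  - intros k. destruct (Rle_lt_dec r (b (S m + k)%nat)) as [|Hlt]; [assumption|].
    destruct Hm as [_ Hm]. specialize (Hm (S m + k)%nat ltac:(split; [lia | assumption])).
    lia.
Qed.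

Lemma kernel_le_nevanlinna_B (a b : nat -> R) (y P : R) (N : nat) :
  (forall n, 0 < b n) -> 0 < y ->
  (forall M, kernel a b 0 M <= P) ->
  ex_series (fun n => Cmod (poly_q a b n 0 * poly_p a b n (Ci * y))) ->
  kernel a b (Ci * y) N <= P * Cmod (nevanlinna_B a b (Ci * y)) ^ 2.
Proof.
  intros hb hy HP Hs.
  assert (Hlim := is_lim_seq_Cmod_CSeries _ (- (1))%C (Ci * y)%C Hs).
  fold (nevanlinna_B a b (Ci * y)) in Hlim.
  refine (is_lim_seq_le_loc (fun _ => kernel a b (Ci * y) N) _
            (kernel a b (Ci * y) N)
            (P * Cmod (nevanlinna_B a b (Ci * y)) ^ 2) _ (is_lim_seq_const _)
            (is_lim_seq_mult' _ _ _ _ (is_lim_seq_const P)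
              (is_lim_seq_mult' _ _ _ _ Hlim
                (is_lim_seq_mult' _ _ _ _ Hlim (is_lim_seq_const 1))))).
  exists N. intros M HM.
  assert (HB := kernel_le_wronskian_p_q a b y M hb hy).
  rewrite wronskian_poly_p_q in HB by exact hb.
  replace (Ci * y - 0)%C with (Ci * y)%C in HB by ring.
  eapply Rle_trans; [apply kernel_mono, HM|].
  eapply Rle_trans; [exact HB|].
  apply Rmult_le_compat_r; [apply pow2_ge_0 | apply HP].
Qed.

Theorem theorem3p10 (a b : nat -> R) (hb : forall n : nat, 0 < b n)
    (hlc : limit_circle a b) :
  exists c : R, 0 < c /\
  exists r0 : R, forall r : R, r0 <= r ->
  exists (h : nat) (s : R),
    is_h b r h /\
    is_series (fun k : nat => / b (h + k)%nat) s /\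
    c * r * s <= ln (Cmod (nevanlinna_B a b (Ci * RtoC r))).
Proof.
  assert (HX := limit_circle_poly_p_Ci a b hb hlc).
  assert (Hinv := ex_series_inv_b a b hb HX).
  set (x := fun n => Cmod (poly_p a b n (Ci * RtoC 1))).
  assert (Hdom := fun z u => solution_dominated a b z u hb HX).
  destruct (Hdom _ _ (solves_poly_q a b 0 hb)) as (L & HL0 & HL).
  set (P := Series (fun n => Cmod (poly_p a b n 0) ^ 2)).
  assert (HP : forall M, kernel a b 0 M <= P).
  { intros M. apply sum_n_le_Series; [intros; apply pow2_ge_0|].
    destruct (Hdom _ _ (solves_poly_p a b 0 hb)) as (K & HK0 & HK).
    apply (ex_series_ext (fun n => Cmod (poly_p a b n 0) * Cmod (poly_p a b n 0))).
    - intros n. symmetry. simpl. now rewrite Rmult_1_r.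
    - apply ex_series_mult_dominated with x K K; [exact HX | |];
        intros n; (split; [apply Cmod_ge_0 | apply HK]). }
  assert (HP1 : 1 <= P) by (rewrite <- (kernel_0 a b 0); apply HP).
  exists (/ 12). split; [lra|].
  exists (Rmax (b 1%nat + 1) (b 0%nat * P)). intros r Hr.
  assert (Hr1 := Rle_trans _ _ _ (Rmax_l _ _) Hr).
  assert (Hr2 := Rle_trans _ _ _ (Rmax_r _ _) Hr).
  assert (hb0 := hb 0%nat). assert (hb1 := hb 1%nat).
  assert (hr : 0 < r) by lra.
  destruct (is_h_exists b r hb Hinv ltac:(lra)) as (m & Hh & Hbr).
  assert (Hs : ex_series (fun k => / b (S m + k)%nat))
    by now apply (ex_series_incr_n (fun n => / b n)).
  exists (S m), (Series (fun k => / b (S m + k)%nat)).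
  split; [exact Hh|]. split; [now apply Series_correct|].
  set (beta := Cmod (nevanlinna_B a b (Ci * r))).
  assert (HF : forall N, kernel a b (Ci * r) N <= P * beta ^ 2).
  { intros N. apply kernel_le_nevanlinna_B; auto.
    destruct (Hdom _ _ (solves_poly_p a b (Ci * r) hb)) as (K & HK0 & HK).
    apply (ex_series_ext
             (fun n => Cmod (poly_q a b n 0) * Cmod (poly_p a b n (Ci * r)))).
    - intros n. symmetry. apply Cmod_mult.
    - apply ex_series_mult_dominated with x L K; [exact HX | |];
        intros n; (split; [apply Cmod_ge_0 |]); [apply HL | apply HK]. }
  (* The index 1 already shows that [beta ^ 2] dominates [P]: |p_1(ir)| >= r / b_0 >= P. *)
  assert (Hp1 : P <= Cmod (poly_p a b 1 (Ci * r))).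
  { rewrite poly_p_1, Cmod_div, Cmod_R, Rabs_pos_eq by (lra || now apply RtoC_neq0).
    apply Rmult_le_reg_r with (1 := hb0).
    replace (Cmod (Ci * r - a 0%nat) / b 0%nat * b 0%nat)
      with (Cmod (Ci * r - a 0%nat)) by (field; lra).
    assert (H := Cmod_snd_le (Ci * r - a 0%nat)%C). cbn in H.
    replace (0 * 0 + 1 * r + - 0) with r in H by ring.
    rewrite Rabs_pos_eq in H by lra. lra. }
  assert (Hbeta0 : 0 <= beta) by apply Cmod_ge_0.
  assert (HPb : P <= beta ^ 2).
  { assert (H1 := HF 1%nat). rewrite kernel_S, kernel_0 in H1.
    apply Rmult_le_reg_l with P; [lra|]. nra. }
  assert (Hbeta : 0 < beta) by nra.
  assert (Hln : ln P <= 2 * ln beta).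
  { replace (2 * ln beta) with (ln (beta ^ 2))
      by (rewrite ln_pow by exact Hbeta; simpl; ring).
    apply ln_le; lra. }
  assert (Hsum : r * Series (fun k => / b (S m + k)%nat) <= 3 * ln (P * beta ^ 2)).
  { refine (is_lim_seq_le _ (fun _ => 3 * ln (P * beta ^ 2)) _
              (3 * ln (P * beta ^ 2)) _
              (is_lim_seq_mult' _ _ _ _ (is_lim_seq_const r) (Series_correct _ Hs))
              (is_lim_seq_const _)).
    intros K. eapply Rle_trans; [now apply (sum_n_inv_le_ln_kernel a b)|].
    apply Rmult_le_compat_l; [lra|]. apply ln_le; [|apply HF].
    assert (H := kernel_ge_1 a b (Ci * r) (S (S m + K))). lra. }
  rewrite ln_mult, ln_pow in Hsum by (auto; try lra; apply pow_lt; lra).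
  simpl INR in Hsum. lra.
Qed.
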